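(* Let $\lambda\in\varrho(A_\beta)$. There is a one-to-one correspondence between the closed operators $\widetilde A-\lambda$ with $A_{\min}-\lambda\subset\widetilde A-\lambda\subset A_{\max}-\lambda$ and the closed, densely defined operators $T^\lambda:V_\lambda\to W_{\bar\lambda}$, where $V_\lambda$ and $W_{\bar\lambda}$ are closed subspaces of $Z_\lambda$ resp. $Z'_{\bar\lambda}$; here $$D(T^\lambda)=\mathrm{pr}^\lambda_\zeta D(\widetilde A),\quad V_\lambda=\overline{D(T^\lambda)},\quad W_{\bar\lambda}=\overline{\mathrm{pr}^{\bar\lambda}_{\zeta'}D(\widetilde A^* )},$$ $$T^\lambda u^\lambda_\zeta=((A-\lambda)u)_{W_{\bar\lambda}}\ \text{ for }u\in D(\widetilde A),$$ $$D(\widetilde A)=\{u\in D(A_{\max})\mid u^\lambda_\zeta\in D(T^\lambda),\ ((A-\lambda)u)_{W_{\bar\lambda}}=T^\lambda u^\lambda_\zeta\}.$$ In this correspondence, $$\ker(\widetilde A-\lambda)=\ker T^\lambda,\qquad \operatorname{ran}(\widetilde A-\lambda)=\operatorname{ran}T^\lambda+(H\ominus W_{\bar\lambda})\quad(\text{orthogonal sum}).$$ In particular, if $\lambda\in\varrho(\widetilde A)$, $$(\widetilde A-\lambda)^{-1}=(A_\beta-\lambda)^{-1}+\mathrm{i}_{V_\lambda\to H}(T^\lambda)^{-1}\mathrm{pr}_{W_{\bar\lambda}}.$$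
   Context: Setting: $H$ is a complex Hilbert space; $A_{\min}$ and $A'_{\min}$ are closed, densely defined operators in $H$ such that $A_{\min}\subset A_{\max}:=(A'_{\min})^*$ and $A'_{\min}\subset A'_{\max}:=(A_{\min})^*$. $A_\beta$ is a closed, densely defined operator with $A_{\min}\subset A_\beta\subset A_{\max}$ and $0\in\varrho(A_\beta)$ ($\varrho$ denotes the resolvent set); then $A'_{\min}\subset A_\beta^*\subset A'_{\max}$. For $u\in D(A_{\max})$, $Au$ means $A_{\max}u$. For a closed subspace $U$ of $H$, $\mathrm{pr}_U$ is the orthogonal projection onto $U$, $f_U=\mathrm{pr}_Uf$, and $\mathrm{i}_{U\to H}$ is the injection. For $\lambda\in\varrho(A_\beta)$: $Z_\lambda=\ker(A_{\max}-\lambda)$, $Z'_{\bar\lambda}=\ker(A'_{\max}-\bar\lambda)$; $\mathrm{pr}^\lambda_\zeta=I-(A_\beta-\lambda)^{-1}(A_{\max}-\lambda):D(A_{\max})\to Z_\lambda$, $u^\lambda_\zeta=\mathrm{pr}^\lambda_\zeta u$; $\mathrm{pr}^{\bar\lambda}_{\zeta'}=I-(A_\beta^*-\bar\lambda)^{-1}(A'_{\max}-\bar\lambda):D(A'_{\max})\to Z'_{\bar\lambda}$. *)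

(* Defs.v *)
From mathcomp Require Import all_boot all_order all_algebra sesquilinear complex.
From mathcomp Require Import boolp classical_sets functions reals topology.
From mathcomp Require Import normedtype.
Set Implicit Arguments.
Unset Strict Implicit.
Unset Printing Implicit Defensive.
Import Order.TTheory GRing.Theory Num.Theory.
Import numFieldNormedType.Exports.
Local Open Scope classical_set_scope.
Local Open Scope ring_scope.

(* The inner product is linear in its first argument and conjugate-linear in
   its second one. *)
Record hilbert (R : realType) := Hilbert {
  hilbert_sort :> completeNormedModType R[i];
  inner : {dot hilbert_sort for (@Num.conj R[i])};
  inner_norm : forall u : hilbert_sort, inner u u = `|u| ^+ 2 }.

Definition subspace (K : pzRingType) (E : lmodType K) (S : set E) : Prop :=
  S 0 /\ forall (a : K) (u v : E), S u -> S v -> S (a *: u + v).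

(* An unbounded operator in H is identified with its graph, so that the
   inclusion of operators is the inclusion of graphs and an operator is closed
   when its graph is closed in the product topology. *)
Section Operators.
Variables (R : realType) (H : hilbert R).
Implicit Types (A B M : set (H * H)) (U : set H) (l : R[i]).

Definition operator A : Prop :=
  subspace A /\ forall u f g : H, A (u, f) -> A (u, g) -> f = g.

Definition closed_operator A : Prop := operator A /\ closed A.

Definition dom A : set H := [set u | exists f, A (u, f)].

Definition ran A : set H := [set f | exists u, A (u, f)].

Definition ker A : set H := [set u | A (u, 0)].

Definition densely_defined A : Prop := closure (dom A) = setT.

(* The value of A at u, with the junk value 0 if u is not in dom A. *)
Definition app A (u : H) : H := xget 0 [set f | A (u, f)].

Definition inverse A : set (H * H) := [set p | A (p.2, p.1)].

Definition minus_scalar A l : set (H * H) :=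
  [set (p.1, p.2 - l *: p.1) | p in A].

(* This relation is (the graph of) an operator iff A is densely defined. *)
Definition adjoint A : set (H * H) :=
  [set q | forall p, A p -> inner H p.2 q.1 = inner H p.1 q.2].

Definition resolvent_set A : set R[i] :=
  [set l | [/\ ker (minus_scalar A l) = [set 0], ran (minus_scalar A l) = setT &
    exists c : R,
      forall u f : H, minus_scalar A l (u, f) -> `|u| <= c%:C%C * `|f|]].

Definition closed_subspace U : Prop := subspace U /\ closed U.

Definition orthocomplement U : set H :=
  [set y | forall x, U x -> inner H x y = 0].

(* Orthogonal projection onto a closed subspace U. *)
Definition pr U (f : H) : H :=
  xget 0 [set p | U p /\ orthocomplement U (f - p)].

(* I - (B - l)^-1 (M - l), on dom M *)
Definition pr_zeta B M l (u : H) : H :=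
  u - app (inverse (minus_scalar B l)) (app (minus_scalar M l) u).

(* An operator from one subspace of H to another. The subspaces are part of the
   data: the target is not determined by the graph. *)
Record operator_between := OperatorBetween {
  source : set H;
  target : set H;
  graph : set (H * H) }.

(* When V and W are closed in H, the graph is closed in V x W iff it is closed
   in H x H, and the domain is dense in V iff its closure in H is V. *)
Definition closed_dense_between (Z Z' : set H) : set operator_between :=
  [set T | [/\ closed_subspace (source T) /\ source T `<=` Z,
     closed_subspace (target T) /\ target T `<=` Z',
     graph T `<=` source T `*` target T,
     closed_operator (graph T) &
     closure (dom (graph T)) = source T]].

(* The operators A such that A - l is closed and
   Amin - l \subset A - l \subset Amax - l. *)
Definition closed_extensions (Amin Amax : set (H * H)) l : set (set (H * H)) :=
  [set A | [/\ closed_operator (minus_scalar A l),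
     minus_scalar Amin l `<=` minus_scalar A l &
     minus_scalar A l `<=` minus_scalar Amax l]].

Definition boundary_operator (Amin Amin' Abeta : set (H * H)) l
    (A : set (H * H)) : operator_between :=
  let Amax := adjoint Amin' in
  let Amax' := adjoint Amin in
  let V := closure (pr_zeta Abeta Amax l @` dom A) in
  let W := closure (pr_zeta (adjoint Abeta) Amax' l^* @` dom (adjoint A)) in
  OperatorBetween V W
    [set (pr_zeta Abeta Amax l u, pr W (app (minus_scalar Amax l) u)) | u in dom A].

End Operators.

(* Main.v *)
(** Replacing every operator by its shift by [l], write [b] for the bounded
inverse of the shifted [Abeta]. Every pair [(u, f)] in the maximal operator
splits as [(b f, f) + (u - b f, 0)], whose second component lies in [Z], so an
extension [A] amounts to a closed linear relation between [Z] and [H], namely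
the set of the [(u - b f, f)] for [(u, f)] in [A]. Its multivalued part is
[N = {f | (b f, f) in A}], which contains the range of the minimal operator;
since [A] is its own double adjoint, [N] is the orthogonal complement of the
image under [zeta'] of the domain of the adjoint of [A]. Hence [W] is the
orthogonal complement of [N], and the operator part of the relation is
[T = {(z, w) | w in W, (z + b w, w) in A}]. Conversely [(u, f)] is in [A] iff
[(u - b f, pr W f)] is in [T]. *)
Require Import Defs.
From HB Require Import structures.
From mathcomp Require Import all_boot all_order all_algebra sesquilinear complex.
From mathcomp Require Import boolp classical_sets functions reals topology.
From mathcomp Require Import normedtype ring.
Set Implicit Arguments.
Unset Strict Implicit.
Unset Printing Implicit Defensive.
Import Order.TTheory GRing.Theory Num.Theory.
Import numFieldNormedType.Exports.
Local Open Scope classical_set_scope.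
Local Open Scope ring_scope.

(* [subspace] also names a construction of the topology library. *)
Local Notation subspace := Defs.subspace.

(** * Projection theorem for a positive definite Hermitian form *)

Section Projection.
Variables (R : realType) (E : lmodType R[i]) (q : {dot E for (@Num.conj R[i])}).
Implicit Types (u v s x : E) (S : set E).

Lemma dot_conj u v : q u v = (q v u)^*.
Proof. by rewrite hermC /= expr0 mul1r. Qed.

Lemma dot_eq0C u v : q u v = 0 -> q v u = 0.
Proof. by rewrite dot_conj => /eqP; rewrite conjC_eq0 => /eqP. Qed.

Lemma dotBl u v s : q (u - v) s = q u s - q v s.
Proof. exact: linearBl. Qed.

Lemma dotBr u v s : q s (u - v) = q s u - q s v.
Proof. exact: linearBr. Qed.

Lemma dotNl u v : q (- u) v = - q u v.
Proof. exact: linearNl. Qed.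

(** The best multiple of [s] lowers the square of [u] by [|q u s| ^+ 2 / q s s], so this drop is at
    most [e]. With [e := q u u] this is Cauchy-Schwarz; with small [e] it makes near-minimisers
    almost orthogonal. *)
Lemma dot_near_min (u s : E) (e : R[i]) :
    (forall a, q u u <= q (u - a *: s) (u - a *: s) + e) ->
  `|q u s| ^+ 2 <= e * q s s.
Proof.
move=> min_u; have [->|s0] := eqVneq s 0.
  by rewrite linear0l linear0r normr0 expr0n mulr0.
have qs : 0 < q s s by rewrite dnorm_gt0.
(* The minimising coefficient of [a] in [q (u - a *: s) (u - a *: s)]. *)
have := min_u (q u s / q s s).
rewrite dnormB dnormZ [q u (_ *: s)]linearZr /= rmorphM /= fmorphV /= -[(q s s)^*]dot_conj.
have -> : (q u s)^* / q s s * q u s = `|q u s| ^+ 2 / q s s.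
  by rewrite normCKC mulrAC.
have -> : (`|q u s| ^+ 2 / q s s)^* = `|q u s| ^+ 2 / q s s.
  by rewrite geC0_conj // divr_ge0 ?exprn_ge0 // ltW.
rewrite normrM expr2 [`|(q s s)^-1|]ger0_norm ?invr_ge0 ?(ltW qs) //.
rewrite -ler_pdivrMr //.
set t := `|q u s| ^+ 2 / q s s.
have -> : `|q u s| / q s s * (`|q u s| / q s s) * q s s = t.
  by rewrite /t expr2; field; rewrite gt_eqF.
move=> h; rewrite -subr_ge0 in h; rewrite -subr_ge0.
by move: h; congr (0 <= _); ring.
Qed.

Lemma dot_cauchy_schwarz u v : `|q u v| ^+ 2 <= q u u * q v v.
Proof.
by apply: dot_near_min => a; rewrite lerDr dnorm_ge0.
Qed.

Lemma dot_inf (S : set E) x (e : R[i]) : S !=set0 -> 0 < e ->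
  exists2 p, S p & forall s, S s -> q (x - p) (x - p) <= q (x - s) (x - s) + e.
Proof.
move=> [s0 Ss0] e0.
have rl (z : R[i]) : 0 <= z -> (complex.Re z)%:C%C = z.
  by move=> z0; apply: RRe_real; apply: ger0_real.
(* [R[i]] is only partially ordered; the infimum is taken in [R], through real parts. *)
pose D := [set complex.Re (q (x - s) (x - s)) | s in S].
have hD : has_inf D.
  split; first by exists (complex.Re (q (x - s0) (x - s0))); exists s0.
  exists 0 => _ [s Ss <-]; rewrite -lecR rl ?dnorm_ge0 //.
have e'0 : 0 < complex.Re e by rewrite -ltcR rl // ltW.
have [_ [p Sp <-] hp] := inf_adherent e'0 hD.
exists p => // s Ss; rewrite -(rl _ (dnorm_ge0 q (x - p))) -(rl _ (dnorm_ge0 q (x - s))).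
rewrite -[in leRHS](rl e (ltW e0)) -rmorphD lecR (le_trans (ltW hp)) // lerD2r.
by apply: ge_inf; [case: hD | exists s].
Qed.

(* Completeness is expressed through the form alone, because [H * H] carries the
   max norm, which does not come from its inner product. *)
Definition dot_complete S :=
  forall p : nat -> E, (forall n, S (p n)) ->
    (forall e : R[i], 0 < e -> exists N, forall m n, (N <= m)%N -> (N <= n)%N ->
       q (p m - p n) (p m - p n) < e) ->
  exists2 y, S y & forall e : R[i], 0 < e -> exists N, forall n, (N <= n)%N ->
       q (y - p n) (y - p n) < e.

Lemma sub_subspace S u v : subspace S -> S u -> S v -> S (u - v).
Proof. by case=> _ h Su Sv; rewrite addrC -scaleN1r; apply: h. Qed.

Lemma scale_subspace S a u : subspace S -> S u -> S (a *: u).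
Proof. by case=> S0 h Su; rewrite -[_ *: _]addr0; apply: h. Qed.

Lemma add_subspace S u v : subspace S -> S u -> S v -> S (u + v).
Proof. by case=> _ h Su Sv; rewrite -[u]scale1r; apply: h. Qed.

(** Parallelogram law: the midpoint of [u] and [v] lies in [S], so it cannot beat either by more
    than the tolerances, which bounds the other diagonal [u - v]. *)
Lemma dot_min_close S x u v (d e : R[i]) : subspace S -> S u -> S v ->
    (forall s, S s -> q (x - u) (x - u) <= q (x - s) (x - s) + d) ->
    (forall s, S s -> q (x - v) (x - v) <= q (x - s) (x - s) + e) ->
  q (u - v) (u - v) <= 2 * d + 2 * e.
Proof.
move=> subS Su Sv min_u min_v.
pose w : E := 2^-1 *: (u + v).
have Sw : S w by apply: scale_subspace => //; apply: add_subspace.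
have pl : q (u - v) (u - v) + 4 * q (x - w) (x - w)
    = 2 * q (x - u) (x - u) + 2 * q (x - v) (x - v).
  have -> : 4 * q (x - w) (x - w) = q (2 *: (x - w)) (2 *: (x - w)).
    by rewrite dnormZ ger0_norm // -natrX.
  have -> : 2 *: (x - w) = (x - u) + (x - v).
    rewrite scalerBr /w scalerA mulfV ?scale1r ?pnatr_eq0 //.
    by rewrite scaler_nat mulr2n opprD addrACA.
  have -> : u - v = (x - v) - (x - u) by rewrite opprB [RHS]addrC addrA subrK.
  move: (x - u) (x - v) => a b; rewrite dnormB dnormD (dot_conj a b) conjCK; ring.
have h := lerD (min_u _ Sw) (min_v _ Sw).
rewrite -subr_ge0 in h; rewrite -subr_ge0.
have -> : 2 * d + 2 * e - q (u - v) (u - v) = 2 * d + 2 * e + 4 * q (x - w) (x - w)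
   - (q (u - v) (u - v) + 4 * q (x - w) (x - w)) by ring.
rewrite pl; have : 0 <= 2 :> R[i] by []. move/mulr_ge0 => /(_ _ h).
by congr (0 <= _); ring.
Qed.

(** A minimising sequence is Cauchy by [dot_min_close]. Its limit inherits orthogonality from the
    approximate orthogonality of the near-minimisers. *)
Lemma orthogonal_projection S x : subspace S -> dot_complete S ->
  exists2 p, S p & forall s, S s -> q (x - p) s = 0.
Proof.
move=> subS complS.
have S0 : S !=set0 by exists 0; case: subS.
have /choice [p hp] : forall n : nat, exists p, S p /\
    forall s, S s -> q (x - p) (x - p) <= q (x - s) (x - s) + n.+1%:R^-1.
  by move=> n; have [|p ? ?] := @dot_inf S x n.+1%:R^-1 S0; [rewrite invr_gt0|exists p].
have small (e : R[i]) : 0 < e -> exists N, forall n : nat, (N <= n)%N -> n.+1%:R^-1 < e.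
  move=> e0; exists (Num.truncn (complex.Re e)^-1) => n hn.
  have er : e = (complex.Re e)%:C%C by rewrite RRe_real // ger0_real // ltW.
  have e0' : 0 < complex.Re e by rewrite -ltcR -er.
  rewrite er -(rmorph_nat (real_complex R)) -fmorphV ltcR.
  rewrite invf_plt ?posrE //.
  by rewrite (lt_le_trans (truncnS_gt _)) // ler_nat ltnS.
have [|e e0|y Sy hy] := complS p; first by move=> n; case: (hp n).
  (* The bound [2 * d + 2 * e] of [dot_min_close] must fall below [e]. *)
  have [|N hN] := small (e / 4); first by rewrite divr_gt0.
  exists N => m n Nm Nn; have [[Sm min_m] [Sn min_n]] := (hp m, hp n).
  have close_mn := dot_min_close subS Sm Sn min_m min_n.
  apply: (le_lt_trans close_mn).
  rewrite (_ : e = 2 * (e / 4) + 2 * (e / 4)); last by field.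
  by rewrite ltrD // ltr_pM2l // hN.
exists y => // s Ss; apply: contrapT => /eqP ys0.
have qs : 0 < q s s.
  rewrite dnorm_gt0; apply: contraNneq ys0 => ->; by rewrite linear0r.
(* For large [n] both [|q (x - p n) s|] and [|q (y - p n) s|] are below half of [|q (x - y) s|],
   against the triangle inequality; [c / 4] is the square of that half. *)
pose c := `|q (x - y) s| ^+ 2.
have c0 : 0 < c by rewrite exprn_gt0 // normr_gt0.
have [|N1 hN1] := small (c / 4 / q s s); first by rewrite !divr_gt0.
have [|N2 hN2] := hy (c / 4 / q s s); first by rewrite !divr_gt0.
pose n := maxn N1 N2; have [Sn min_n] := hp n.
have h1 : `|q (x - p n) s| ^+ 2 < c / 4.
  rewrite (@le_lt_trans _ _ (n.+1%:R^-1 * q s s)) //; last first.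
    by rewrite -ltr_pdivlMr // hN1 // leq_maxl.
  apply: dot_near_min => a; rewrite -addrA -opprD; apply: min_n.
  by rewrite addrC; case: subS => _; apply.
have h2 : `|q (y - p n) s| ^+ 2 < c / 4.
  rewrite (le_lt_trans (dot_cauchy_schwarz _ _)) //.
  by rewrite -ltr_pdivlMr // hN2 // leq_maxr.
have half_c : `|q (x - y) s| ^+ 2 / 4 = (`|q (x - y) s| / 2) ^+ 2.
  by rewrite expr_div_n -natrX.
move: h1 h2; rewrite /c half_c !ltr_pXn2r ?nnegrE ?divr_ge0 // => h1 h2.
have tri : `|q (x - y) s| <= `|q (x - p n) s| + `|q (y - p n) s|.
  have -> : x - y = (x - p n) - (y - p n) by rewrite opprB addrA subrK.
  by rewrite linearBl ler_normB.
have := le_lt_trans tri (ltrD h1 h2).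
by rewrite -splitr ltxx.
Qed.

End Projection.

(** * Completeness of closed sets in [H] and [H * H], measured by inner products *)

Section Hilbert.
Variables (R : realType) (H : hilbert R).
Implicit Types (u v f : H) (U : set H) (A : set (H * H)).

Lemma inner_le u v : `|inner H u v| <= `|u| * `|v|.
Proof.
rewrite -(@ler_pXn2r _ 2) ?nnegrE ?mulr_ge0 //.
by rewrite exprMn -!inner_norm dot_cauchy_schwarz.
Qed.

Lemma norm_inner_lt u (e : R[i]) : 0 < e ->
  (`|u| < e) = (inner H u u < e ^+ 2).
Proof. by move=> e0; rewrite inner_norm ltr_pXn2r ?nnegrE // ltW. Qed.

Lemma seq_cauchy_cvg (p : nat -> H) :
    (forall e : R[i], 0 < e -> exists N, forall m n, (N <= m)%N -> (N <= n)%N ->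
       `|p m - p n| < e) ->
  exists y : H, p n @[n --> \oo] --> y.
Proof.
move=> cauchy_p; 
suff /cvg_ex : cvg (p n @[n --> \oo]) by [].
apply: cauchy_cvg; apply: cauchy_exP => e e0.
have [N hN] := cauchy_p _ e0; exists (p N).
exists N => // n /= Nn; rewrite -ball_normE /=.
by apply: hN.
Qed.

Lemma cvg_dist_lt (p : nat -> H) y : p n @[n --> \oo] --> y ->
  forall e : R[i], 0 < e -> exists N, forall n, (N <= n)%N -> `|y - p n| < e.
Proof.
move=> /cvgrPdist_lt py e /py [N _ hN]; exists N => n Nn; exact: hN.
Qed.

Lemma closed_dot_complete U : closed U -> dot_complete (inner H) U.
Proof.
move=> closedU p Up cauchy_p; have [|y py] := @seq_cauchy_cvg p.
  move=> e e0; have [|N hN] := cauchy_p (e ^+ 2); first by rewrite exprn_gt0.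
  by exists N => m n Nm Nn; rewrite norm_inner_lt // hN.
exists y; first by apply: (closed_cvg _ closedU _ _ py); apply: nearW.
move=> e e0; have [|N hN] := cvg_dist_lt py (e := sqrtC e); first by rewrite sqrtC_gt0.
by exists N => n /hN; rewrite norm_inner_lt ?sqrtC_gt0 // sqrtCK.
Qed.

(** The inner product of the Hilbert sum of two copies of [H], set up so that the projection theorem
    applies to graphs. *)
Definition inner_prod (p q : H * H) : R[i] :=
  inner H p.1 q.1 + inner H p.2 q.2.

Let inner_prodC p q : inner_prod p q = (-1) ^+ false * (inner_prod q p)^*.
Proof.
by rewrite expr0 mul1r /inner_prod rmorphD /= -!dot_conj.
Qed.

Let inner_prodl q : GRing.linear_for *%R (inner_prod^~ q).
Proof. by move=> a x y; rewrite /inner_prod /= !linearDl !linearZl /=; ring. Qed.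

Let inner_prodr p : GRing.linear_for (Num.conj \; *%R) (inner_prod p).
Proof. by move=> a x y; rewrite /inner_prod /= !linearDr !linearZr /=; ring. Qed.

HB.instance Definition _ := bilinear_isBilinear.Build R[i] (H * H)%type (H * H)%type R[i]
  *%R (Num.conj \; *%R) inner_prod (inner_prodl, inner_prodr).
HB.instance Definition _ := isHermitianSesquilinear.Build R[i] (H * H)%type false
  Num.conj inner_prod inner_prodC.

Let inner_prod_gt0 p : p != 0 -> 0 < inner_prod p p.
Proof.
case: p => u v uv0; rewrite lt_neqAle addr_ge0 ?dnorm_ge0 // andbT eq_sym.
apply: contraNneq uv0 => /eqP; rewrite paddr_eq0 ?dnorm_ge0 // !dnorm_eq0 /=.
by case/andP=> /eqP -> /eqP ->.
Qed.

HB.instance Definition _ := isDotProduct.Build R[i] (H * H)%type inner_prod inner_prod_gt0.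

Lemma closed_dot_complete_prod A : closed A -> dot_complete inner_prod A.
Proof.
move=> closedA p Ap cauchy_p.
have [|u pu] := @seq_cauchy_cvg (fun n => (p n).1).
  move=> e e0; have [|N hN] := cauchy_p (e ^+ 2); first by rewrite exprn_gt0.
  exists N => m n Nm Nn; rewrite norm_inner_lt // (le_lt_trans _ (hN _ _ Nm Nn)) //.
  by rewrite /= /inner_prod lerDl dnorm_ge0.
have [|v pv] := @seq_cauchy_cvg (fun n => (p n).2).
  move=> e e0; have [|N hN] := cauchy_p (e ^+ 2); first by rewrite exprn_gt0.
  exists N => m n Nm Nn; rewrite norm_inner_lt // (le_lt_trans _ (hN _ _ Nm Nn)) //.
  by rewrite /= /inner_prod lerDr dnorm_ge0.
exists (u, v).
  apply: (@closed_cvg _ _ \oo _ p _ closedA); first exact: nearW.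
  rewrite (_ : p = fun n => ((p n).1, (p n).2)); last by apply/funext => n; case: (p n).
  exact: cvg_pair.
move=> e e0; have e20 : 0 < sqrtC (e / 2) by rewrite sqrtC_gt0 divr_gt0.
have [N1 hN1] := cvg_dist_lt pu e20; have [N2 hN2] := cvg_dist_lt pv e20.
exists (maxn N1 N2) => n; rewrite geq_max => /andP[/hN1 h1 /hN2 h2].
move: h1 h2; rewrite !norm_inner_lt // sqrtCK => h1 h2.
by rewrite [e]splitr /= /inner_prod ltrD.
Qed.

Lemma orthocomplement_subspace U : subspace (orthocomplement U).
Proof.
split=> [x _|a u v ou ov x Ux]; first by rewrite linear0r.
by rewrite linearDr linearZr /= ou // ov // mulr0 addr0.
Qed.

Lemma lipschitz_continuous (E F : normedModType R[i]) (g : E -> F) (c : R[i]) :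
  0 <= c -> (forall x y, `|g x - g y| <= c * `|x - y|) -> continuous g.
Proof.
move=> c0 g_lip x; apply/cvgrPdist_lt => e e0.
(* A positive divisor even when [c] is 0. *)
have c1 : 0 < c + 1 by rewrite ltr_wpDl.
near=> y.
have xy : `|x - y| < e / (c + 1).
  near: y; move/cvgrPdist_lt: (@cvg_id _ (nbhs x)) => /(_ (e / (c + 1))).
  by apply; rewrite divr_gt0.
rewrite (le_lt_trans (g_lip _ _)) // (@le_lt_trans _ _ ((c + 1) * `|x - y|)) //.
  by rewrite ler_wpM2r // lerDl.
by rewrite mulrC -ltr_pdivlMr.
Unshelve. all: by end_near. Qed.

End Hilbert.

(** * Orthogonal complements, Riesz representation and the double adjoint *)

Section Complements.
Variables (R : realType) (H : hilbert R).
Implicit Types (u v f g : H) (U : set H) (A : set (H * H)).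

Lemma closed_zeros (E F : normedModType R[i]) (g : E -> F) (c : R[i]) :
  0 <= c -> (forall x y, `|g x - g y| <= c * `|x - y|) -> closed [set x | g x = 0].
Proof.
move=> c0 /(lipschitz_continuous c0)/continuous_closedP g_cont.
apply: (g_cont [set 0]); apply: accessible_closed_set1.
exact/hausdorff_accessible/norm_hausdorff.
Qed.

Lemma orthocomplement_closed U : closed (orthocomplement U).
Proof.
rewrite (_ : orthocomplement U = \bigcap_(x in U) [set y | inner H x y = 0]) //.
apply: closed_bigI => x _; apply: (@closed_zeros H R[i]^o (inner H x) `|x|) => // y z.
by rewrite -linearBr inner_le.
Qed.

Lemma orthocomplement_closed_subspace U : closed_subspace (orthocomplement U).
Proof. by split; [exact: orthocomplement_subspace | exact: orthocomplement_closed]. Qed.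

Lemma sub_orthocomplementK U : U `<=` orthocomplement (orthocomplement U).
Proof. by move=> x Ux y /(_ x Ux) /dot_eq0C. Qed.

Lemma orthocomplement_self U x : U x -> orthocomplement U x -> x = 0.
Proof. by move=> Ux /(_ x Ux) /eqP; rewrite dnorm_eq0 => /eqP. Qed.

Lemma closureP (E : normedModType R[i]) (X : set E) x :
  closure X x <-> forall e : R[i], 0 < e -> exists2 y, X y & `|x - y| < e.
Proof.
split=> [clX e e0|near_X].
  have [|y [Xy]] := clX (ball x e); first exact: nbhsx_ballx.
  by rewrite -ball_normE; exists y.
move=> B /nbhs_ballP [e /= e0 sub_B]; have [y Xy xy] := near_X e e0.
by exists y; split=> //; apply: sub_B; rewrite -ball_normE.
Qed.

Lemma closure_subspace (E : normedModType R[i]) (X : set E) :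
  subspace X -> subspace (closure X).
Proof.
move=> [X0 XP]; split=> [|a x y /closureP clx /closureP cly]; first exact: subset_closure.
apply/closureP => e e0.
have a1 : 0 < `|a| + 1 by rewrite ltr_wpDl.
have [|x' Xx' xx'] := clx (e / 2 / (`|a| + 1)); first by rewrite !divr_gt0.
have [|y' Xy' yy'] := cly (e / 2); first by rewrite divr_gt0.
exists (a *: x' + y'); first exact: XP.
rewrite opprD addrACA -scalerBr (le_lt_trans (ler_normD _ _)) // [ltRHS]splitr.
apply: ler_ltD => //; rewrite normrZ; move: xx'; rewrite ltr_pdivlMr // => /ltW.
by apply: le_trans; rewrite mulrC ler_wpM2l // lerDl.
Qed.

Lemma prP U f : closed_subspace U -> U (pr U f) /\ orthocomplement U (f - pr U f).
Proof.
move=> [subU closedU]; rewrite /pr; case: xgetP => [p _ //|].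
have [p Up op] := orthogonal_projection f subU (closed_dot_complete closedU).
by move=> /(_ p); case; split=> // s /op /dot_eq0C.
Qed.

Lemma pr_unique U f p : subspace U -> U p -> orthocomplement U (f - p) -> pr U f = p.
Proof.
move=> subU Up op; rewrite /pr; case: xgetP => [p' _ [Up' op']|/(_ p)]; last by case.
apply/eqP; rewrite -subr_eq0; apply/eqP.
apply: (orthocomplement_self (sub_subspace subU Up' Up)).
have -> : p' - p = (f - p) - (f - p') by rewrite opprB [RHS]addrC addrA subrK.
exact: (sub_subspace (orthocomplement_subspace U) op op').
Qed.

Lemma pr_id U f : subspace U -> U f -> pr U f = f.
Proof.
move=> subU Uf; apply: pr_unique => //; rewrite subrr.
by case: (orthocomplement_subspace U).
Qed.

Lemma pr_eq0 U f : closed_subspace U -> pr U f = 0 <-> orthocomplement U f.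
Proof.
move=> cU; split=> [p0|of_]; first by have [_] := prP f cU; rewrite p0 subr0.
by apply: pr_unique; rewrite ?subr0 //; case: cU => // -[].
Qed.

Lemma pr_linear U a f g : closed_subspace U ->
  pr U (a *: f + g) = a *: pr U f + pr U g.
Proof.
move=> cU; have [subU _] := cU; have [Uf of_] := prP f cU; have [Ug og] := prP g cU.
apply: pr_unique => //; first by case: subU => _; apply.
rewrite opprD addrACA -scalerBr.
by case: (orthocomplement_subspace U) => _; apply.
Qed.

Lemma pr_norm_le U f : closed_subspace U -> `|pr U f| <= `|f|.
Proof.
move=> cU; have [Uf of_] := prP f cU.
rewrite -(@ler_pXn2r _ 2) ?nnegrE // -!inner_norm.
rewrite -[in leRHS](subrK (pr U f) f) addrC dnormD (of_ _ Uf) conjC0 !addr0.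
by rewrite lerDl dnorm_ge0.
Qed.

Lemma orthocomplementK U : closed_subspace U -> orthocomplement (orthocomplement U) = U.
Proof.
move=> cU; apply/seteqP; split=> [x oox|]; last exact: sub_orthocomplementK.
have [Ux ox] := prP x cU; rewrite -(subrK (pr U x) x).
rewrite (_ : x - pr U x = 0) ?add0r //; apply: (orthocomplement_self ox).
exact: (sub_subspace (orthocomplement_subspace _) oox (sub_orthocomplementK Ux)).
Qed.

(** The double complement of [U] is closed and contains [U], hence contains its closure. *)
Lemma orthocomplement_closure U : orthocomplement (closure U) = orthocomplement U.
Proof.
apply/seteqP; split=> [y oy x /subset_closure /oy //|y oy x clx].
have clO : closed (orthocomplement (orthocomplement U)) by exact: orthocomplement_closed.
have oox : orthocomplement (orthocomplement U) x.
  by move/closure_id: clO => ->; exact: (closureS (sub_orthocomplementK (U := U)) clx).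
exact: (dot_eq0C (oox _ oy)).
Qed.

Lemma closure_eq_orthocomplement U N : subspace U -> orthocomplement U = N ->
  closure U = orthocomplement N.
Proof.
move=> subU <-; rewrite -(orthocomplement_closure U) orthocomplementK //.
by split; [exact: closure_subspace | exact: closed_closure].
Qed.

(** A nonzero bounded [phi] has a closed kernel [K], and the residual [e] of a vector outside [K] is
    orthogonal to [K]; the representing vector is a multiple of [e]. *)
Lemma riesz (phi : H -> R[i]) (c : R[i]) :
    (forall a x y, phi (a *: x + y) = a * phi x + phi y) ->
    (forall x, `|phi x| <= c * `|x|) -> 0 <= c ->
  exists w, forall f, inner H f w = phi f.
Proof.
move=> phiP phi_le c0.
have phi0 : phi 0 = 0.
  by apply/eqP; rewrite -normr_le0 (le_trans (phi_le _)) // normr0 mulr0.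
pose K := [set x | phi x = 0].
have cK : closed_subspace K.
  split; first by split=> // a x y; rewrite /K /= phiP => -> ->; rewrite mulr0 addr0.
  apply: (@closed_zeros H R[i]^o phi c) => // x y.
  by rewrite addrC -mulN1r -phiP scaleN1r addrC phi_le.
have [all0|] := pselect (forall x, phi x = 0).
  by exists 0 => f; rewrite linear0r all0.
move=> /existsNP [x /eqP phix].
have [Kx ox] := prP x cK; set e := x - pr K x in ox.
have phie : phi e = phi x by rewrite /e addrC -scaleN1r phiP Kx mulr0 add0r.
have e0 : e != 0 by apply: contraNneq phix => e0; rewrite -phie e0 phi0.
have ee : inner H e e != 0 by rewrite dnorm_eq0.
exists ((phi e / inner H e e)^* *: e) => f.
(* Every [f] is a vector of [K] plus a multiple of [e], and only the latter pairs with [e]. *)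
have Kf : K (f - (phi f / phi e) *: e).
  by rewrite /K /= addrC -scaleNr phiP mulNr divfK ?phie // addNr.
have /eqP := ox _ Kf; rewrite linearBl linearZl /= subr_eq0 => /eqP fe.
rewrite linearZr /= conjCK fe; field.
by rewrite ee phie phix.
Qed.

Lemma subspace_adjoint A : subspace (adjoint A).
Proof.
split=> [p _|a p q adj_p adj_q r Ar] /=; first by rewrite !linear0r.
by rewrite !linearDr !linearZr /= (adj_p _ Ar) (adj_q _ Ar).
Qed.

(** Project [(u, f)] onto the closed graph [A]. The residual [(r, s)] is orthogonal to [A], so
    [(s, - r)] is in the adjoint; testing [(u, f)] and its projection against it gives
    [|s|^2 = - |r|^2], so the residual vanishes. *)
Lemma adjointK A : subspace A -> closed A -> adjoint (adjoint A) `<=` A.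
Proof.
move=> subA closedA [u f] adjA.
have [[u0 f0] A0 o0] :=
  orthogonal_projection (u, f) subA (closed_dot_complete_prod closedA).
have adj_o : adjoint A (f - f0, - (u - u0)).
  move=> p Ap; apply/eqP; rewrite linearNr /= -addr_eq0 addrC; apply/eqP.
  exact: (dot_eq0C (q := inner_prod (H := H)) (o0 _ Ap)).
have := adjA _ adj_o; have /= := adj_o _ A0 => h0 /= h1.
have fE : inner H (f - f0) (f - f0) = - inner H (u - u0) (u - u0).
  by rewrite dotBr -h1 [inner H _ f0]dot_conj h0 -dot_conj -dotBr dotNl.
have : inner H (f - f0) (f - f0) + inner H (u - u0) (u - u0) == 0 by rewrite fE addNr.
rewrite paddr_eq0 ?dnorm_ge0 // !dnorm_eq0 !subr_eq0 => /andP[/eqP -> /eqP ->] //.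
Qed.

End Complements.

(** * Linear relations, their values and inverses *)

Section Relations.
Variables (R : realType) (H : hilbert R).
Implicit Types (u v f g : H) (S A : set (H * H)).

Lemma operator_add S u f v g : subspace S -> S (u, f) -> S (v, g) -> S (u + v, f + g).
Proof. by move=> subS Suf Svg; exact: (add_subspace subS Suf Svg). Qed.

Lemma operator_sub S u f v g : subspace S -> S (u, f) -> S (v, g) -> S (u - v, f - g).
Proof. by move=> subS Suf Svg; exact: (sub_subspace subS Suf Svg). Qed.

Lemma operatorP S : subspace S -> (forall f, S (0, f) -> f = 0) -> operator S.
Proof.
move=> subS S0; split=> // u f g Suf Sug; apply/eqP; rewrite -subr_eq0; apply/eqP.
by apply: S0; rewrite -(subrr u); exact: operator_sub.
Qed.

Lemma appE S u f : operator S -> S (u, f) -> app S u = f.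
Proof.
move=> [_ S_fun] Suf; rewrite /app; case: xgetP => [g _ Sug|/(_ f) //].
exact: S_fun Sug Suf.
Qed.

Lemma app_total S u : dom S = setT -> S (u, app S u).
Proof.
move=> domS; have [f Suf] : dom S u by rewrite domS.
by rewrite /app; case: xgetP => [g _ //|/(_ f)].
Qed.

Lemma app_linear S a u v : operator S -> dom S = setT ->
  app S (a *: u + v) = a *: app S u + app S v.
Proof.
move=> opS domS; apply: appE => //; have [[_ SP] _] := opS.
exact: (SP a _ _ (app_total u domS) (app_total v domS)).
Qed.

Lemma inverse_subspace S : subspace S -> subspace (inverse S).
Proof.
move=> [S0 SP]; split=> [|a [u f] [v g]]; first exact: S0.
exact: (SP a (f, u) (g, v)).
Qed.

Lemma ker0_inverse_operator S : subspace S -> ker S = [set 0] -> operator (inverse S).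
Proof.
move=> subS kerS; apply: operatorP; first exact: inverse_subspace.
by move=> u /= Su0; have : ker S u by []; rewrite kerS.
Qed.

(** A value of the adjoint at 0 is orthogonal to the dense set [dom A]. *)
Lemma dense_adjoint_operator A : densely_defined A -> operator (adjoint A).
Proof.
move=> denseA; apply: operatorP; first exact: subspace_adjoint.
move=> f adjf; suff : orthocomplement (dom A) f.
  rewrite -orthocomplement_closure denseA; exact: (@orthocomplement_self _ _ setT).
by move=> u [g Aug]; have /= <- := adjf _ Aug; rewrite linear0r.
Qed.

End Relations.

(** * The correspondence for already shifted operators, with [B] boundedly invertible *)

Section Extensions.
Variables (R : realType) (H : hilbert R).
Variables (Bmin Bmin' B : set (H * H)) (c : R[i]).
Implicit Types (u v w f g z : H) (A : set (H * H)).

Let Bmax := adjoint Bmin'.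
Let Bmax' := adjoint Bmin.
Let Z := ker Bmax.
Let Z' := ker Bmax'.
Let b := app (inverse B).
Let b' := app (inverse (adjoint B)).
Let zeta u := u - b (app Bmax u).
Let zeta' v := v - b' (app Bmax' v).

Hypotheses (opBmax : operator Bmax) (opBmax' : operator Bmax') (subB : subspace B).
Hypotheses (BminB : Bmin `<=` B) (BBmax : B `<=` Bmax).
Hypotheses (kerB : ker B = [set 0]) (ranB : ran B = setT).
Hypotheses (c0 : 0 <= c) (B_ge : forall u f, B (u, f) -> `|u| <= c * `|f|).

Let opb : operator (inverse B).
Proof. exact: (ker0_inverse_operator subB kerB). Qed.

Let bP f : B (b f, f).
Proof. exact: (@app_total _ _ (inverse B) f ranB). Qed.

Let bE u f : B (u, f) -> b f = u.
Proof. exact: (appE opb). Qed.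

Let b_linear a f g : b (a *: f + g) = a *: b f + b g.
Proof. exact: app_linear. Qed.

Let b0 : b 0 = 0.
Proof. by apply: bE; case: subB. Qed.

Let bB f g : b (f - g) = b f - b g.
Proof. by rewrite addrC -scaleN1r b_linear scaleN1r addrC. Qed.

Let b_le f : `|b f| <= c * `|f|.
Proof. exact: B_ge. Qed.

Let b_cont : continuous b.
Proof. by apply: (lipschitz_continuous c0) => f f'; rewrite -bB. Qed.

(** The kernel of the adjoint is orthogonal to [ran B], which is all of [H]. *)
Let opb' : operator (inverse (adjoint B)).
Proof.
apply: ker0_inverse_operator; first exact: subspace_adjoint.
apply/seteqP; split=> [v adjv|_ ->]; last by case: (subspace_adjoint B).
have ov : orthocomplement setT v; last exact: (orthocomplement_self I ov).
move=> f _; by have /= -> := adjv _ (bP f); rewrite linear0r.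
Qed.

(** A preimage of [g] under the adjoint is the vector that represents the bounded functional [f] to
    [inner H (b f) g]. *)
Let domb' : dom (inverse (adjoint B)) = setT.
Proof.
apply/seteqP; split=> // g _.
have [|f||w hw] := @riesz _ H (fun f => inner H (b f) g) (c * `|g|).
- by move=> a x y; rewrite b_linear linearDl linearZl.
- rewrite (le_trans (inner_le _ _)) // mulrAC ler_wpM2r //.
- by rewrite mulr_ge0.
by exists w => -[u f] /= Buf; rewrite hw (bE Buf).
Qed.

Let b'P f g : inner H f (b' g) = inner H (b f) g.
Proof. exact: (@app_total _ _ (inverse (adjoint B)) g domb' _ (bP f)). Qed.

Let b'_linear a f g : b' (a *: f + g) = a *: b' f + b' g.
Proof. exact: app_linear. Qed.

(** This and [boundary] are [closed_extensions] and [boundary_operator] with the shift absorbed into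
    the operators. *)
Definition extension A := [/\ closed_operator A, Bmin `<=` A & A `<=` Bmax].

Definition boundary A : operator_between H :=
  let W := closure (zeta' @` dom (adjoint A)) in
  OperatorBetween (closure (zeta @` dom A)) W
    [set (zeta u, pr W (app Bmax u)) | u in dom A].

Let adjoint_sub A : extension A -> adjoint A `<=` Bmax'.
Proof. by move=> [_ minA _] q adjq p /minA /adjq. Qed.

Let zetaE A u f : extension A -> A (u, f) -> zeta u = u - b f.
Proof. by move=> [_ _ maxA] Auf; rewrite /zeta (appE opBmax (maxA _ Auf)). Qed.

Let zeta'E A v g : extension A -> adjoint A (v, g) -> zeta' v = v - b' g.
Proof. by move=> extA adjA; rewrite /zeta' (appE opBmax' (adjoint_sub extA adjA)). Qed.

Let zeta'_subspace A : extension A -> subspace (zeta' @` dom (adjoint A)).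
Proof.
move=> extA; have [adj0 adjP] := subspace_adjoint A; split.
  have b'0 : b' 0 = 0 by apply: appE => //; case: (subspace_adjoint B).
  by exists 0; [exists 0; exact: adj0 | rewrite (zeta'E extA adj0) b'0 subrr].
move=> a _ _ [u [f adjf] <-] [v [g adjg] <-].
have adjfg := adjP a _ _ adjf adjg; exists (a *: u + v); first by exists (a *: f + g).
rewrite (zeta'E extA adjf) (zeta'E extA adjg) (zeta'E extA adjfg) /= b'_linear.
by rewrite scalerBr opprD addrACA.
Qed.

Let zeta_subspace A : extension A -> subspace (zeta @` dom A).
Proof.
move=> extA; have [[[[A0 AP] _] _] _ _] := extA; split.
  by exists 0; [exists 0; exact: A0 | rewrite (zetaE extA A0) b0 subrr].
move=> a _ _ [u [f Af] <-] [v [g Ag] <-].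
have Afg := AP a _ _ Af Ag; exists (a *: u + v); first by exists (a *: f + g).
rewrite (zetaE extA Af) (zetaE extA Ag) (zetaE extA Afg) /= b_linear.
by rewrite scalerBr opprD addrACA.
Qed.

Let nul A := [set f | A (b f, f)].

(** For [(v, g)] in the adjoint, [inner H (zeta' v) y] equals [inner H v y - inner H g (b y)]. It
    vanishes for all such pairs exactly when [(b y, y)] is in the double adjoint of [A], which is
    [A]. *)
Let orthocomplement_zeta' A : extension A ->
  orthocomplement (zeta' @` dom (adjoint A)) = nul A.
Proof.
move=> extA; have [[[subA _] closedA] _ _] := extA.
have orthE v g y : adjoint A (v, g) ->
    inner H (zeta' v) y = 0 <-> inner H g (b y) = inner H v y.
  move=> adjA; rewrite (zeta'E extA adjA) dotBl [inner H (b' g) y]dot_conj b'P -dot_conj.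
  by split=> [/eqP|->]; [rewrite subr_eq0 => /eqP | rewrite subrr].
apply/seteqP; split=> [y oy|y Ay _ [v [g adjA] <-]].
  by apply: adjointK => // -[v g] adjA; apply/(orthE _ _ _ adjA)/oy; exists v => //; exists g.
apply/(orthE _ _ _ adjA); have /= := adjA _ Ay => e.
by rewrite [RHS]dot_conj e -dot_conj.
Qed.

(** * Properties of the boundary operator of one extension *)

Section OneExtension.
Variables (A : set (H * H)) (extA : extension A).
Let T := graph (boundary A).
Let W := target (boundary A).

Let subA : subspace A. Proof. by have [[[]]] := extA. Qed.

Lemma target_boundary : W = orthocomplement (nul A).
Proof.
by apply: closure_eq_orthocomplement;
  [exact: zeta'_subspace | exact: orthocomplement_zeta'].
Qed.

Lemma orthocomplement_target : orthocomplement W = nul A.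
Proof. by rewrite orthocomplement_closure orthocomplement_zeta'. Qed.

Lemma closed_subspace_target : closed_subspace W.
Proof. by rewrite target_boundary; exact: orthocomplement_closed_subspace. Qed.

Let A_nul f : orthocomplement W f -> A (b f, f).
Proof. by rewrite orthocomplement_target. Qed.

(** For [(u, f)] in [A], the part [y] of [f] orthogonal to [W] gives a pair [(b y, y)] of [A];
    removing it replaces [f] by its projection and keeps [u - b f] unchanged. *)
Lemma graph_boundaryP z w : T (z, w) <-> W w /\ A (z + b w, w).
Proof.
have cW := closed_subspace_target; split=> [[u [f Auf] [<- <-]]|[Ww Azw]].
  have [_ _ maxA] := extA; rewrite (zetaE extA Auf) (appE opBmax (maxA _ Auf)) -/W.
  have [Wf of_] := prP f cW; split=> //.
  have := operator_sub subA Auf (A_nul of_).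
  by rewrite bB subKr opprB addrA addrAC.
have [_ _ maxA] := extA.
exists (z + b w); first by exists w.
by rewrite (zetaE extA Azw) addrK (appE opBmax (maxA _ Azw)) -/W pr_id //; case: cW.
Qed.

Lemma extension_graph u f : A (u, f) <-> T (u - b f, pr W f).
Proof.
have cW := closed_subspace_target; have [Wf of_] := prP f cW.
rewrite graph_boundaryP; split=> [Auf|[_ Az]].
  split=> //; have := operator_sub subA Auf (A_nul of_).
  by rewrite bB subKr opprB addrA addrAC.
have := operator_add subA Az (A_nul of_).
by rewrite bB [pr W f + _]addrC subrK -addrA [b (pr W f) + _]addrCA subrr addr0 subrK.
Qed.


Lemma dom_boundary : dom T = zeta @` dom A.
Proof.
apply/seteqP; split=> [z [w [u Au [<- _]]]|_ [u Au <-]]; first by exists u.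
by exists (pr W (app Bmax u)); exists u.
Qed.

Lemma graph_boundary_subspace : subspace T.
Proof.
have [[W0 WP] _] := closed_subspace_target; have [A0 AP] := subA.
split=> [|a [z w] [z' w'] /graph_boundaryP [Ww Azw] /graph_boundaryP [Ww' Azw']].
  by apply/graph_boundaryP; rewrite b0 addr0; split; [exact: W0 | exact: A0].
apply/graph_boundaryP; split; first exact: WP.
by have := AP a _ _ Azw Azw'; rewrite b_linear addrACA -scalerDr.
Qed.

(** By [graph_boundaryP], [T] is cut out by closed conditions on continuous images of the pair. *)
Lemma graph_boundary_closed : closed T.
Proof.
have [_ closedW] := closed_subspace_target; have [[_ closedA] _ _] := extA.
pose g (p : H * H) := (p.1 + b p.2, p.2).
have -> : T = (snd @^-1` W) `&` (g @^-1` A).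
  by apply/seteqP; split=> -[z w] /graph_boundaryP.
apply: closedI.
  have /continuous_closedP : continuous (@snd H H) by move=> p; exact: cvg_snd.
  by apply.
have /continuous_closedP : continuous g; last by apply.
move=> p; apply: cvg_pair; last exact: cvg_snd.
by apply: cvgD; [exact: cvg_fst | apply: (cvg_comp _ _ cvg_snd); exact: b_cont].
Qed.

(** A value [w] at 0 lies both in [W] and in [nul A], its orthogonal complement. *)
Lemma graph_boundary_operator : operator T.
Proof.
apply: operatorP; first exact: graph_boundary_subspace.
move=> w /graph_boundaryP [Ww]; rewrite add0r => Aw.
have ow : orthocomplement W w by rewrite orthocomplement_target.
exact: (orthocomplement_self Ww ow).
Qed.

Lemma ker_adjoint (S : set (H * H)) : ker (adjoint S) = orthocomplement (ran S).
Proof.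
apply/seteqP; split=> [u adju f [v Svf]|u ou [v f] Svf] /=.
  by have /= -> := adju _ Svf; rewrite linear0r.
by rewrite linear0r ou //; exists v.
Qed.

Lemma boundary_closed_dense : closed_dense_between Z Z' (boundary A).
Proof.
have [_ minA maxA] := extA; have cW := closed_subspace_target; split.
- split; first by split; [exact/closure_subspace/zeta_subspace | exact: closed_closure].
  (* Since [Z] is closed, it suffices that each [u - b f] lies in it: [Bmax] sends both [u] and
     [b f] to [f]. *)
  have closedZ : closed Z by rewrite /Z ker_adjoint; exact: orthocomplement_closed.
  rewrite [X in _ `<=` X](closure_id Z).1 //; apply: closureS.
  move=> _ [u [f Auf] <-]; rewrite (zetaE extA Auf) /Z /ker /= -(subrr f).
  by have [subM _] := opBmax; exact: (operator_sub subM (maxA _ Auf) (BBmax (bP f))).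
(* [nul A] contains the range of [Bmin], because [b f] is [u] there; so [W] is orthogonal to that
   range. *)
- split=> // w Ww; rewrite /Z' ker_adjoint => f [u muf].
  have ow : orthocomplement (nul A) w by rewrite -target_boundary.
  by apply: ow; rewrite /nul /= (bE (BminB muf)); exact: minA.
- move=> [z w] /[dup] Tzw /graph_boundaryP [Ww _]; split=> //=.
  by apply: subset_closure; rewrite -dom_boundary; exists w.
- by split; [exact: graph_boundary_operator | exact: graph_boundary_closed].
by rewrite -/T dom_boundary.
Qed.

Lemma app_boundary u : dom A u -> app T (zeta u) = pr W (app Bmax u).
Proof. by move=> Au; apply: appE; [exact: graph_boundary_operator | exists u]. Qed.

Lemma dom_extension : dom A = [set u | [/\ dom Bmax u, dom T (zeta u) &
  pr W (app Bmax u) = app T (zeta u)]].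
Proof.
apply/seteqP; split=> [u Au|u [[f Muf] [w Tw]]] /=.
  have [_ _ maxA] := extA; split; last by rewrite app_boundary.
    by case: Au => f /maxA; exists f.
  by rewrite dom_boundary; exists u.
rewrite (appE graph_boundary_operator Tw) /zeta (appE opBmax Muf) => prf.
by exists f; apply/extension_graph; rewrite prf -(appE opBmax Muf).
Qed.

Lemma ker_extension : ker A = ker T.
Proof.
have [[W0 _] _] := closed_subspace_target.
apply/seteqP; split=> [u Au|u /graph_boundaryP [_]]; last by rewrite b0 addr0.
by apply/graph_boundaryP; rewrite b0 addr0.
Qed.

Lemma ran_extension : ran A = [set x + y | x in ran T & y in orthocomplement W].
Proof.
apply/seteqP; split=> [f [u /extension_graph Tf]|_ [w [z /graph_boundaryP [_ Az]] [y oy <-]]].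
  have [_ of_] := prP f closed_subspace_target.
  exists (pr W f); first by exists (u - b f).
  by exists (f - pr W f) => //; rewrite addrC subrK.
by exists (z + b w + b y); exact: operator_add (A_nul oy).
Qed.

Lemma boundary_orthogonal x y : ran T x -> orthocomplement W y -> inner H x y = 0.
Proof. by move=> [z /graph_boundaryP [Wx _]] /(_ _ Wx). Qed.

Lemma boundary_resolvent : ker A = [set 0] -> ran A = setT ->
  [/\ operator (inverse T), dom (inverse T) = W &
    forall f, app (inverse A) f = b f + app (inverse T) (pr W f)].
Proof.
move=> kerA ranA; have opT : operator (inverse T).
  apply: ker0_inverse_operator; first exact: graph_boundary_subspace.
  by rewrite -ker_extension.
split=> //.
  apply/seteqP; split=> [w [z /graph_boundaryP []] //|w Ww].
  have [u Auw] : ran A w by rewrite ranA.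
  by exists (u - b w); apply/graph_boundaryP; rewrite subrK.
move=> f; have [u Auf] : ran A f by rewrite ranA.
rewrite (appE (ker0_inverse_operator subA kerA) (Auf : inverse A (f, u))).
(* [extension_graph] says that the inverse of [T] sends [pr W f] to [u - b f]. *)
rewrite (appE opT ((extension_graph u f).1 Auf : inverse T (pr W f, u - b f))).
by rewrite addrC subrK.
Qed.

End OneExtension.

(** * Bijectivity of the correspondence *)

Lemma boundary_inj : set_inj extension boundary.
Proof.
move=> A1 A2 /set_mem ext1 /set_mem ext2 eqT.
(* [extension_graph] recovers an extension from the graph and the target, both fields of the
   record. *)
apply/seteqP; split=> -[u f].
  by move=> /(extension_graph ext1); rewrite eqT => /(extension_graph ext2).
by move=> /(extension_graph ext2); rewrite -eqT => /(extension_graph ext1).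
Qed.

Lemma boundary_surj : set_surj extension (closed_dense_between Z Z') boundary.
Proof.
move=> [V W G] [/= [[subV closedV] VZ] [cW WZ'] GVW [opG closedG] denseG].
have [subG _] := opG; have [subW _] := cW.
(* The only possible preimage, as forced by [extension_graph]. *)
pose A := [set p | G (p.1 - b p.2, pr W p.2)].
have extA : extension A.
  have maxA : A `<=` Bmax.
    move=> [u f] /= /GVW [/= /VZ Zu _]; 
    rewrite (_ : (u, f) = (u - b f + b f, 0 + f)); last by rewrite subrK add0r.
    by have [subM _] := opBmax; exact: (operator_add subM Zu (BBmax (bP f))).
  split=> //.
    split; last first.
      have /continuous_closedP : continuous (fun p : H * H => (p.1 - b p.2, pr W p.2)).
        have pr_cont : continuous (pr W).
          apply: (lipschitz_continuous ler01) => f f'; rewrite mul1r.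
          rewrite addrC -scaleN1r -pr_linear // scaleN1r addrC; exact: pr_norm_le.
        move=> p; apply: cvg_pair; last by apply: (cvg_comp _ _ cvg_snd); exact: pr_cont.
        apply: cvgD; first exact: cvg_fst.
        by apply: cvgN; apply: (cvg_comp _ _ cvg_snd); exact: b_cont.
      by apply.
    have [G0 GP] := subG; split; last first.
      by move=> u f g /maxA Muf /maxA Mug; case: opBmax => _; apply; eassumption.
    split=> [|a [u f] [v g] /= Guf Gvg].
      by rewrite /A /= b0 subr0 pr_id //; case: subW.
    rewrite /A /= b_linear pr_linear // opprD addrACA -scalerBr.
    exact: (GP a _ _ Guf Gvg).
  (* On [Bmin] the pair fed to [G] is [(0, 0)]: [b f] is [u], and [f] is orthogonal to [Z'], which
     contains [W]. *)
  move=> [u f] muf; rewrite /A /= (bE (BminB muf)) subrr.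
  rewrite (pr_eq0 f cW).2; first by case: subG.
  move=> w /WZ'; rewrite /Z' ker_adjoint => ow; apply: dot_eq0C; apply: ow; by exists u.
exists A => //.
(* Since [G] is single-valued, [nul A] consists of the [f] with [pr W f = 0], the complement of
   [W]. *)
have targetA : target (boundary A) = W.
  rewrite target_boundary // -[RHS]orthocomplementK //; congr orthocomplement.
  apply/seteqP; split=> f; rewrite /nul /A /= subrr.
    by move=> G0; apply/pr_eq0 => //; case: opG => _ /(_ 0 _ 0 G0); apply; case: subG.
  by move=> /(pr_eq0 f cW).2 ->; case: subG.
have graphA : graph (boundary A) = G.
  apply/seteqP; split=> -[z w].
    by move=> /(graph_boundaryP extA); rewrite targetA /A /= addrK => -[Ww]; rewrite pr_id.
  move=> Gzw; have [_ /= Ww] := GVW _ Gzw.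
  by apply/graph_boundaryP => //; rewrite targetA /A /= addrK pr_id.
have sourceA : source (boundary A) = V.
  by rewrite -denseG -graphA dom_boundary.
by move: targetA graphA sourceA; case: (boundary A) => ? ? ? /= -> -> ->.
Qed.

End Extensions.

(** * Shifting operators by a scalar *)

Section Shift.
Variables (R : realType) (H : hilbert R).
Implicit Types (A : set (H * H)) (l : R[i]).

Lemma minus_scalarP A l (u f : H) : minus_scalar A l (u, f) <-> A (u, f + l *: u).
Proof.
split=> [[[v g] Avg [<- <-]] /=|Auf]; first by rewrite subrK.
by exists (u, f + l *: u) => //=; rewrite addrK.
Qed.

Lemma minus_scalarS A A' l : A `<=` A' -> minus_scalar A l `<=` minus_scalar A' l.
Proof. by move=> AA' [u f] /minus_scalarP/AA'/minus_scalarP. Qed.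

Lemma minus_scalarK l : cancel (@minus_scalar R H ^~ l) (@minus_scalar R H ^~ (- l)).
Proof.
move=> A; apply/seteqP; split=> -[u f].
  by move=> /minus_scalarP/minus_scalarP; rewrite scaleNr subrK.
by move=> Auf; apply/minus_scalarP/minus_scalarP; rewrite scaleNr subrK.
Qed.

Lemma dom_minus_scalar A l : dom (minus_scalar A l) = dom A.
Proof.
apply/seteqP; split=> u [f]; first by move=> /minus_scalarP; exists (f + l *: u).
by move=> Auf; exists (f - l *: u); apply/minus_scalarP; rewrite subrK.
Qed.

Lemma minus_scalar_subspace A l : subspace A -> subspace (minus_scalar A l).
Proof.
move=> [A0 AP]; split=> [|a [u f] [v g] /minus_scalarP Auf /minus_scalarP Avg].
  by apply/minus_scalarP; rewrite scaler0 addr0.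
apply/minus_scalarP; have := AP a _ _ Auf Avg.
congr (A (_, _)); rewrite /= !scalerDr addrACA; congr (_ + (_ + _)).
by rewrite !scalerA mulrC.
Qed.

Lemma adjoint_minus_scalar A l :
  adjoint (minus_scalar A l) = minus_scalar (adjoint A) l^*.
Proof.
have eqE (u f v g : H) : inner H (f - l *: u) v = inner H u g <->
    inner H f v = inner H u (g + l^* *: v).
  rewrite dotBl linearDr linearZr linearZl /= conjCK.
  by split=> [<-|->]; rewrite ?subrK ?addrK.
apply/seteqP; split=> -[v g].
  move=> adj; apply/minus_scalarP => -[u f] Auf /=; apply/eqE.
  by apply: (adj (u, f - l *: u)); apply/minus_scalarP; rewrite subrK.
move=> /minus_scalarP adj [u f] /minus_scalarP /adj /= /eqE.
by rewrite addrK.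
Qed.

Lemma densely_defined_minus_scalar A l :
  densely_defined A -> densely_defined (minus_scalar A l).
Proof. by rewrite /densely_defined dom_minus_scalar. Qed.

Lemma boundary_operator_shift (Amin Amin' Abeta A : set (H * H)) l :
  boundary_operator Amin Amin' Abeta l A =
  boundary (minus_scalar Amin l) (minus_scalar Amin' l^*) (minus_scalar Abeta l)
    (minus_scalar A l).
Proof.
by rewrite /boundary_operator /boundary /pr_zeta !adjoint_minus_scalar conjCK
  !dom_minus_scalar.
Qed.

End Shift.

(** * The correspondence at the spectral parameter [l] *)

Theorem corollary2p3 (R : realType) (H : hilbert R)
    (Amin Amin' Abeta : set (H * H)) (l : R[i])
    (hAmin : closed_operator Amin /\ densely_defined Amin)
    (hAmin' : closed_operator Amin' /\ densely_defined Amin')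
    (hmax : Amin `<=` adjoint Amin') (hmax' : Amin' `<=` adjoint Amin)
    (hAbeta : closed_operator Abeta /\ densely_defined Abeta)
    (hbeta_min : Amin `<=` Abeta) (hbeta_max : Abeta `<=` adjoint Amin')
    (h0 : resolvent_set Abeta 0) (hl : resolvent_set Abeta l) :
  let Amax := adjoint Amin' in
  let Amax' := adjoint Amin in
  let Z := ker (minus_scalar Amax l) in
  let Z' := ker (minus_scalar Amax' l^*) in
  let zeta := pr_zeta Abeta Amax l in
  let zeta' := pr_zeta (adjoint Abeta) Amax' l^* in
  let Tl := boundary_operator Amin Amin' Abeta l in
  set_bij (closed_extensions Amin Amax l) (closed_dense_between Z Z') Tl /\
  forall A, closed_extensions Amin Amax l A ->
    let V := source (Tl A) in
    let W := target (Tl A) in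
    let T := graph (Tl A) in
    [/\ dom T = zeta @` dom A,
        V = closure (dom T),
        W = closure (zeta' @` dom (adjoint A)),
        forall u, dom A u -> app T (zeta u) = pr W (app (minus_scalar Amax l) u) &
        dom A = [set u | [/\ dom Amax u, dom T (zeta u) &
                   pr W (app (minus_scalar Amax l) u) = app T (zeta u)]]] /\
    [/\ ker (minus_scalar A l) = ker T,
        ran (minus_scalar A l) = [set x + y | x in ran T & y in orthocomplement W],
        forall x y, ran T x -> orthocomplement W y -> inner H x y = 0 &
        resolvent_set A l ->
          [/\ operator (inverse T), dom (inverse T) = W &
            forall f, app (inverse (minus_scalar A l)) f =
              app (inverse (minus_scalar Abeta l)) f + app (inverse T) (pr W f)]].
Proof.
have [dense_min dense_min'] := (proj2 hAmin, proj2 hAmin').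
have subB : subspace (minus_scalar Abeta l).
  by apply: minus_scalar_subspace; have [[[]]] := hAbeta.
have [kerB ranB [c B_le]] := hl.
(* The resolvent bound [c] comes without a sign; its absolute value serves as the nonnegative
   bound. *)
have c0 : 0 <= `|c%:C%C| :> R[i] by [].
have B_ge u f : minus_scalar Abeta l (u, f) -> `|u| <= `|c%:C%C| * `|f|.
  move=> /B_le /le_trans; apply; rewrite ler_wpM2r //; apply: real_ler_norm.
  by apply/complex_realP; exists c.
set Bmin := minus_scalar Amin l; set Bmin' := minus_scalar Amin' l^*.
have opBmax : operator (adjoint Bmin').
  exact/dense_adjoint_operator/densely_defined_minus_scalar.
have opBmax' : operator (adjoint Bmin).
  exact/dense_adjoint_operator/densely_defined_minus_scalar.
have BmaxE : minus_scalar (adjoint Amin') l = adjoint Bmin'.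
  by rewrite adjoint_minus_scalar conjCK.
have BminB : Bmin `<=` minus_scalar Abeta l by exact: minus_scalarS.
have BBmax : minus_scalar Abeta l `<=` adjoint Bmin'.
  by rewrite -BmaxE; exact: minus_scalarS.
move=> Amax Amax' Z Z' zeta zeta' Tl.
have ZE : Z = ker (adjoint Bmin') by rewrite /Z BmaxE.
have Z'E : Z' = ker (adjoint Bmin) by rewrite /Z' adjoint_minus_scalar.
have TlE A : Tl A = boundary Bmin Bmin' (minus_scalar Abeta l) (minus_scalar A l).
  exact: boundary_operator_shift.
have extE A : closed_extensions Amin Amax l A = extension Bmin Bmin' (minus_scalar A l).
  by rewrite /closed_extensions /Amax BmaxE.
have zetaE : zeta = fun u => u - app (inverse (minus_scalar Abeta l)) (app (adjoint Bmin') u).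
  by rewrite /zeta /pr_zeta /Amax BmaxE.
split.
  split=> [A|A1 A2|T].
  - rewrite extE TlE ZE Z'E.
    exact: (boundary_closed_dense opBmax opBmax' subB BminB BBmax kerB ranB c0 B_ge).
  - move=> /set_mem; rewrite extE => ext1 /set_mem; rewrite extE => ext2.
    rewrite !TlE => eqT; apply: (can_inj (@minus_scalarK R H l)).
    exact: (boundary_inj opBmax opBmax' subB kerB ranB c0 B_ge
      (mem_set ext1) (mem_set ext2) eqT).
  rewrite ZE Z'E => /(boundary_surj opBmax opBmax' subB BminB BBmax kerB ranB c0 B_ge).
  (* The preimage found for the shifted problem is shifted back by [- l]. *)
  have shiftK A : minus_scalar (minus_scalar A (- l)) l = A.
    by have := minus_scalarK (- l) A; rewrite opprK.
  by move=> [A extA <-]; exists (minus_scalar A (- l)); rewrite ?extE ?TlE shiftK.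
move=> A; rewrite extE TlE => extA V W T.
have domT : dom T = zeta @` dom A by rewrite zetaE /T dom_boundary dom_minus_scalar.
split; last first.
  split.
  - exact: (ker_extension opBmax opBmax' subB kerB ranB c0 B_ge extA).
  - exact: (ran_extension opBmax opBmax' subB kerB ranB c0 B_ge extA).
  - exact: (boundary_orthogonal opBmax opBmax' subB kerB ranB c0 B_ge extA).
  move=> [kerA ranA _].
  exact: (boundary_resolvent opBmax opBmax' subB kerB ranB c0 B_ge extA kerA ranA).
split=> //.
- by rewrite domT zetaE /V /= dom_minus_scalar.
- rewrite /W /= /zeta' /pr_zeta /Amax' !adjoint_minus_scalar.
  by rewrite dom_minus_scalar.
- move=> u Au; rewrite zetaE /Amax BmaxE.
  apply: (app_boundary opBmax opBmax' subB kerB ranB c0 B_ge extA).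
  by rewrite dom_minus_scalar.
rewrite zetaE /Amax -(dom_minus_scalar A l) -(dom_minus_scalar (adjoint Amin') l) BmaxE.
exact: (dom_extension opBmax opBmax' subB kerB ranB c0 B_ge extA).
Qed.
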